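(* There is an absolute constant $c>0$ such that the following holds. Let $d\ge 1$, $m=2^d$, and let $\{\theta_n\}_{n\ge 1}$ be an i.i.d. sequence of random vectors in $\mathbb{R}_+^m$, $\theta_n=(\theta_n^0,\theta_n^1,\dots,\theta_n^{m-1})$, with $\theta_n^0=1$ for all $n$. Put $\theta_n^*:=\max_{i=1,\dots,m-1}\theta_n^i$, and assume that $\{\log\theta_n^*\}$ is an i.i.d. sub-Gaussian sequence with mean $\mathbb{E}\log\theta_n^*\le -I_*<0$ and sub-Gaussian norm $\|\log\theta_n^*\|_{\psi_2}\le\sigma_*\in(0,\infty)$. Let $T:\mathcal{P}_d\to\mathcal{P}_d$ be a Lipschitz map (with respect to the $\ell_1$ norm) with Lipschitz constant $L:=\mathrm{Lip}_T\le 1$, and assume $T(e^{(0)})=e^{(0)}$, where $e^{(0)}=(1,0,\dots,0)$. Let $x=(x^0,\dots,x^{m-1})\in\mathcal{P}_d$ with $x^0>0$, and define $Q_0(x)=x$ and $Q_n(x)=q_{\theta_n}(T(Q_{n-1}(x)))$ for $n\ge 1$. Then for every $n\ge 0$ and every $\varepsilon>0$, $$\|Q_n(x)-e^{(0)}\|\;\le\;2\,\frac{1-x^0}{x^0}\,\big(L\,e^{-I_*+\varepsilon}\big)^n$$ with probability at least $1-\exp(-c\,n\,\varepsilon^2/\sigma_*^2)$.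
   Context: $\mathcal{P}_d$ is the set of probability measures on $\{0,1\}^d$, viewed as the set of probability vectors $x=(x^0,\dots,x^{m-1})$ in $\mathbb{R}^m$, $m=2^d$; $\|\cdot\|$ is the $\ell_1$ norm on $\mathbb{R}^m$. $\mathbb{R}_+=[0,\infty)$. For $\theta\in\mathbb{R}_+^m$ and $x\in\mathcal{P}_d$ with $x^T\theta>0$, $q_\theta(x):=\dfrac{x\odot\theta}{x^T\theta}\in\mathcal{P}_d$, where $x\odot\theta$ is the coordinatewise product and $x^T\theta=\sum_i x^i\theta^i$. $\mathrm{Lip}_T:=\sup_{x\ne y}\|T(x)-T(y)\|/\|x-y\|$. The sub-Gaussian norm of a real random variable $Y$ is the $\psi_2$ Orlicz norm $\|Y\|_{\psi_2}:=\inf\{C>0:\ \mathbb{E}\,\psi_2(|Y|/C)\le 1\}$, $\psi_2(x)=e^{x^2}-1$. *)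

(* Defs.v *)
From HB Require Import structures.
From mathcomp Require Import all_boot all_order all_algebra.
From mathcomp Require Import finmap.
From mathcomp Require Import all_classical all_reals all_analysis.
Set Implicit Arguments.
Unset Strict Implicit.
Unset Printing Implicit Defensive.
Import Order.TTheory GRing.Theory Num.Theory.
Import numFieldNormedType.Exports.
Local Open Scope classical_set_scope.
Local Open Scope ring_scope.

(* R^m, m = 2 ^ d, is the type (2 ^ d).-tuple R, whose canonical              *)
(* measurableType structure is the product sigma-algebra.                     *)

Lemma exp2_gt0 (d : nat) : (0 < 2 ^ d)%N.
Proof. by rewrite expn_gt0. Qed.

Definition idx0 (d : nat) : 'I_(2 ^ d) := Ordinal (exp2_gt0 d).

Section Simplex.
Context {R : realType} {d : nat}.
Implicit Types (x y t : (2 ^ d).-tuple R).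

Definition l1norm (m : nat) (v : m.-tuple R) : R := \sum_(i < m) `|tnth v i|.

Definition vsub (m : nat) (u v : m.-tuple R) : m.-tuple R :=
  [tuple tnth u i - tnth v i | i < m].

Definition simplex : set ((2 ^ d).-tuple R) :=
  [set x | (forall i, 0 <= tnth x i) /\ \sum_(i < 2 ^ d) tnth x i = 1].

Definition e0 : (2 ^ d).-tuple R := [tuple (i == idx0 d)%:R | i < 2 ^ d].

Definition dotp x t : R := \sum_(i < 2 ^ d) tnth x i * tnth t i.

(* Only meaningful when 0 < dotp x t (division by 0 returns 0).               *)
Definition q t x : (2 ^ d).-tuple R :=
  [tuple tnth x i * tnth t i / dotp x t | i < 2 ^ d].

(* The default value 0 is immaterial for 0 < d and nonnegative coordinates.   *)
Definition theta_star t : R :=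
  \big[Num.max/0]_(i < 2 ^ d | i != idx0 d) tnth t i.

(* The supremum is taken in the extended reals, so that it is +oo exactly     *)
(* when T is not Lipschitz on the simplex.                                    *)
Definition Lip (T : (2 ^ d).-tuple R -> (2 ^ d).-tuple R) : \bar R :=
  ereal_sup [set r | exists x y, [/\ simplex x, simplex y, x <> y &
    r = (l1norm (vsub (T x) (T y)) / l1norm (vsub x y))%:E]].

(* th k stands for theta_(k+1): the sequence theta_1, theta_2, ... is         *)
(* numbered from 0.                                                           *)
Fixpoint Q (T : (2 ^ d).-tuple R -> (2 ^ d).-tuple R)
    (th : nat -> (2 ^ d).-tuple R) (n : nat) x : (2 ^ d).-tuple R :=
  if n is k.+1 then q (th k) (T (Q T th k x)) else x.

End Simplex.

Section Probability.
Context {R : realType} {disp : measure_display} {Omega : measurableType disp}.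
Variable P : probability Omega R.

Definition mutually_independent {disp'} {E : measurableType disp'}
    (X : nat -> Omega -> E) : Prop :=
  forall (J : {fset nat}) (A : nat -> set E), (forall j, measurable (A j)) ->
    P (\bigcap_(j in [set` J]) (X j @^-1` A j)) =
    (\big[mule/1%E]_(j <- J) P (X j @^-1` A j)).

Definition identically_distributed {disp'} {E : measurableType disp'}
    (X : nat -> Omega -> E) : Prop :=
  forall (j k : nat) (A : set E), measurable A ->
    P (X j @^-1` A) = P (X k @^-1` A).

Definition iid {disp'} {E : measurableType disp'} (X : nat -> Omega -> E) :
    Prop :=
  [/\ forall n, measurable_fun [set: Omega] (X n),
      mutually_independent X & identically_distributed X].

Definition psi2 (u : R) : R := expR (u ^+ 2) - 1.

(* +oo when Y is not sub-Gaussian.                                            *)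
Definition psi2_norm (Y : Omega -> R) : \bar R :=
  ereal_inf [set C%:E | C in
    [set C : R | 0 < C /\ ('E_P[fun w => psi2 (`|Y w| / C)] <= 1)%E]].

End Probability.

(* Main.v *)
Require Import Defs.
From HB Require Import structures.
From mathcomp Require Import all_boot all_order all_algebra.
From mathcomp Require Import finmap.
From mathcomp Require Import all_classical all_reals all_analysis.
From mathcomp Require Import measurable_realfun.
From mathcomp Require Import ring lra.
(* The odds (1 - x^0) / x^0 against the state 0 are contracted by both steps   *)
(* of the recursion: T multiplies them by at most L (because T fixes e0 and    *)
(* L <= 1), and the Bayes update q multiplies them by at most theta_n^*.       *)
(* Hence the odds of Q_n are at most L^n exp(S_n) times those of x, where      *)
(* S_n is the sum of the log theta_k^*, and S_n is controlled by Chernoff's    *)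
(* bound and the estimate                                                      *)
(*   E exp(l Y) <= exp(l mu + 20 (l sigma)^2)   (l >= 0, E Y <= mu)            *)
(* for a sub-Gaussian variable Y. If some theta_k^* vanishes, the odds of Q_n  *)
(* are zero, so null sets need no separate treatment.                          *)

Set Implicit Arguments.
Unset Strict Implicit.
Unset Printing Implicit Defensive.
Import Order.TTheory GRing.Theory Num.Theory.
Import numFieldNormedType.Exports.
Local Open Scope classical_set_scope.
Local Open Scope ring_scope.

(** * Contraction of the odds *)

(** On the simplex the distance to [e0] is 2 (1 - x^0), hence at most twice the odds. The Lipschitz
    bound for T at its fixed point [e0] therefore shrinks 1 - x^0 by L, and since L <= 1 the
    coordinate x^0 does not decrease ([odds_Lip]). In the Bayes step the normalising factor cancels
    from the odds, and every weight that remains is at most [theta_star] ([odds_q]). Iteration gives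
    the pathwise bound [Q_odds].

    The random part is [subgaussian_sum_tail]: off an event of probability at most exp(- n eps^2 /
    (80 sigma^2)), the sum S_n stays below n (- Istar + eps), and there the pathwise bound is the
    claimed one. Chernoff's bound needs the moment generating function of S_n to factor. As
    independence is given on events only, [independent_integral_prod] first extends it to integrals
    of nonnegative functions. The event itself must be measurable, which [measurable_Q] settles
    through the Lipschitz continuity of T on the simplex. *)

Section Odds.
Context {R : realType} {d : nat}.
Implicit Types (x y t : (2 ^ d).-tuple R).

Definition vertex (j : 'I_(2 ^ d)) : (2 ^ d).-tuple R :=
  [tuple (i == j)%:R | i < 2 ^ d].

Definition odds x : R := (1 - tnth x (idx0 d)) / tnth x (idx0 d).

Lemma simplex_vertex j : simplex (vertex j).
Proof.
split=> [i|]; first by rewrite tnth_mktuple ler0n.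
rewrite (bigD1 j)//= tnth_mktuple eqxx big1 ?addr0// => i ij.
by rewrite tnth_mktuple (negbTE ij).
Qed.

Lemma simplex_sum_others x : simplex x ->
  \sum_(i < 2 ^ d | i != idx0 d) tnth x i = 1 - tnth x (idx0 d).
Proof. by case=> _; rewrite (bigD1 (idx0 d))//= => <-; rewrite addrAC subrr add0r. Qed.

Lemma simplex_le1 x : simplex x -> tnth x (idx0 d) <= 1.
Proof.
move=> sx; rewrite -subr_ge0 -simplex_sum_others// sumr_ge0// => i _.
exact: sx.1.
Qed.

Lemma odds_ge0 x : simplex x -> 0 <= odds x.
Proof. by move=> sx; rewrite divr_ge0 ?subr_ge0 ?simplex_le1//; exact: sx.1. Qed.

Lemma l1norm_sub_e0 x : simplex x ->
  l1norm (vsub x e0) = 2 * (1 - tnth x (idx0 d)).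
Proof.
move=> sx; rewrite /l1norm (bigD1 (idx0 d))//= !tnth_mktuple eqxx distrC.
rewrite ger0_norm ?subr_ge0 ?simplex_le1// mulr_natl mulr2n; congr (_ + _).
rewrite -simplex_sum_others//; apply: eq_bigr => i i0.
by rewrite !tnth_mktuple (negbTE i0) subr0 ger0_norm//; exact: sx.1.
Qed.

Lemma l1norm_ge0 m (v : m.-tuple R) : 0 <= l1norm v.
Proof. exact: sumr_ge0. Qed.

Lemma l1norm_sub_gt0 m (u v : m.-tuple R) : u <> v -> 0 < l1norm (vsub u v).
Proof.
move=> uv; rewrite lt_def l1norm_ge0 andbT; apply: contra_notN uv.
rewrite psumr_eq0// => /allP uv; apply: eq_from_tnth => i.
have := uv i (mem_index_enum _).
by rewrite tnth_mktuple normr_eq0 subr_eq0 => /eqP.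
Qed.

Section Lipschitz_simplex.
Variables (T : (2 ^ d).-tuple R -> (2 ^ d).-tuple R) (L : R).
Hypothesis T_Lip : Lip T = L%:E.

Lemma Lip_l1norm_le x y : simplex x -> simplex y ->
  l1norm (vsub (T x) (T y)) <= L * l1norm (vsub x y).
Proof.
move=> sx sy; have [->|/eqP xy] := eqVneq x y.
  have l10 m (v : m.-tuple R) : l1norm (vsub v v) = 0.
    by apply: big1 => i _; rewrite tnth_mktuple subrr normr0.
  by rewrite !l10 mulr0.
rewrite -ler_pdivrMr ?l1norm_sub_gt0// -lee_fin -T_Lip.
by apply: ereal_sup_ubound; exists x, y.
Qed.

(** For d >= 1 the simplex has two distinct vertices, so the supremum includes an actual nonnegative
    quotient. *)
Lemma Lip_ge0 : (1 <= d)%N -> 0 <= L.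
Proof.
move=> d1; have d2 : (1 < 2 ^ d)%N by rewrite -[1%N](expn0 2) ltn_exp2l.
pose j := Ordinal d2.
have xy : vertex j <> vertex (idx0 d).
  move/(congr1 (fun v => tnth v j)); rewrite !tnth_mktuple eqxx => /eqP.
  by rewrite oner_eq0.
rewrite -(pmulr_lge0 _ (l1norm_sub_gt0 xy)).
exact: le_trans (l1norm_ge0 _) (Lip_l1norm_le (simplex_vertex _)
  (simplex_vertex _)).
Qed.

(** The Lipschitz bound between x and [e0] compares the numerators of the odds; L <= 1 then makes
    the denominator no smaller. *)
Lemma odds_Lip x : L <= 1 -> T e0 = e0 -> {homo T : x / simplex x} ->
    simplex x -> 0 < tnth x (idx0 d) ->
  0 < tnth (T x) (idx0 d) /\ odds (T x) <= L * odds x.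
Proof.
move=> L1 Te0 Ts sx x0; have sT := Ts _ sx.
have := Lip_l1norm_le sx (simplex_vertex (idx0 d)).
rewrite -/e0 Te0 !l1norm_sub_e0// mulrCA ler_pM2l// => TL.
have xT : tnth x (idx0 d) <= tnth (T x) (idx0 d).
  have : L * (1 - tnth x (idx0 d)) <= 1 - tnth x (idx0 d).
    by rewrite ler_piMl// subr_ge0 simplex_le1.
  by lra.
have T0 : 0 < tnth (T x) (idx0 d) by exact: lt_le_trans xT.
split=> //; rewrite /odds mulrA ler_pM// ?subr_ge0 ?simplex_le1//.
  by rewrite invr_ge0 ltW.
by rewrite lef_pV2.
Qed.

End Lipschitz_simplex.

Lemma theta_star_ge0 t : 0 <= theta_star t.
Proof. exact: bigmax_ge_id. Qed.

Section Bayes.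
Variables x t : (2 ^ d).-tuple R.
Hypotheses (sx : simplex x) (x0 : 0 < tnth x (idx0 d)).
Hypotheses (t_ge0 : forall i, 0 <= tnth t i) (t0 : tnth t (idx0 d) = 1).

Lemma dotpE : dotp x t = tnth x (idx0 d) +
  \sum_(i < 2 ^ d | i != idx0 d) tnth x i * tnth t i.
Proof. by rewrite /dotp (bigD1 (idx0 d))//= t0 mulr1. Qed.

Lemma dotp_gt0 : 0 < dotp x t.
Proof.
rewrite dotpE ltr_wpDr// sumr_ge0// => i _.
by rewrite mulr_ge0//; exact: sx.1.
Qed.

Lemma simplex_q : simplex (q t x).
Proof.
split=> [i|].
  by rewrite tnth_mktuple divr_ge0 ?(ltW dotp_gt0)// mulr_ge0//; exact: sx.1.
under eq_bigr do rewrite tnth_mktuple.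
by rewrite -mulr_suml mulfV ?gt_eqF ?dotp_gt0.
Qed.

Lemma q_gt0 : 0 < tnth (q t x) (idx0 d).
Proof. by rewrite tnth_mktuple t0 mulr1 divr_gt0 ?dotp_gt0. Qed.

(** With t^0 = 1, the odds after the update are the sum of x^i t^i / x^0 over i other than 0. *)
Lemma odds_q : odds (q t x) <= theta_star t * odds x.
Proof.
have D0 := dotp_gt0.
have -> : odds (q t x) = (dotp x t - tnth x (idx0 d)) / tnth x (idx0 d).
  by rewrite /odds tnth_mktuple t0 mulr1; field; rewrite !gt_eqF.
rewrite /odds mulrA ler_wpM2r ?invr_ge0 ?(ltW x0)// dotpE addrAC subrr add0r.
rewrite -simplex_sum_others// mulr_sumr; apply: ler_sum => i i0.
by rewrite mulrC ler_wpM2r ?(sx.1)//; exact: le_bigmax_cond.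
Qed.

End Bayes.

(** Membership in the simplex and positivity of coordinate 0 belong to the induction because both
    one-step estimates require them. *)
Lemma Q_odds (T : (2 ^ d).-tuple R -> (2 ^ d).-tuple R) (L : R)
    (th : nat -> (2 ^ d).-tuple R) x n :
  Lip T = L%:E -> 0 <= L -> L <= 1 -> T e0 = e0 -> {homo T : x / simplex x} ->
  (forall n i, 0 <= tnth (th n) i) -> (forall n, tnth (th n) (idx0 d) = 1) ->
  simplex x -> 0 < tnth x (idx0 d) ->
  [/\ simplex (Q T th n x), 0 < tnth (Q T th n x) (idx0 d) &
      odds (Q T th n x) <= L ^+ n * \prod_(k < n) theta_star (th k) * odds x].
Proof.
move=> TL L0 L1 Te0 Ts th_ge0 th0 sx x0.
elim: n => [|n [sQ Q0 IH]] /=; first by split; rewrite // big_ord0 !mul1r.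
have [TQ0 TQ] := odds_Lip TL L1 Te0 Ts sQ Q0; have sTQ := Ts _ sQ.
split; [exact: simplex_q|exact: q_gt0|].
apply: (le_trans (odds_q sTQ TQ0 (th_ge0 n) (th0 n))).
rewrite big_ord_recr/= exprSr.
have -> : L ^+ n * L * (\prod_(i < n) theta_star (th i) * theta_star (th n)) *
  odds x = theta_star (th n) * (L * (L ^+ n * \prod_(i < n) theta_star (th i) *
  odds x)) by ring.
rewrite ler_wpM2l ?theta_star_ge0//; apply: (le_trans TQ).
exact: ler_wpM2l.
Qed.

Lemma l1norm_sub_e0_le_odds x : simplex x -> 0 < tnth x (idx0 d) ->
  l1norm (vsub x e0) <= 2 * odds x.
Proof.
move=> sx x0; rewrite l1norm_sub_e0// ler_pM2l// ler_pdivlMr//.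
by rewrite ler_piMr ?simplex_le1// subr_ge0 simplex_le1.
Qed.

End Odds.

(** * Measurability of the recursion *)

(** F is arbitrary: the preimage of any set is a countable union of fibers of N. *)
Lemma measurable_fun_countable_comp {disp} {Omega : measurableType disp}
    {disp'} {E : measurableType disp'} {C : countType} (N : Omega -> C)
    (F : C -> E) :
  (forall c, measurable (N @^-1` [set c])) ->
  measurable_fun [set: Omega] (F \o N).
Proof.
move=> mN _ A mA; rewrite setTI.
have -> : (F \o N) @^-1` A =
    \bigcup_c (if c \in F @^-1` A then N @^-1` [set c] else set0).
  apply/seteqP; split=> [w /= FA|w [c _]].
    by exists (N w) => //; rewrite mem_set.
  by case: ifPn => // /set_mem/= Fc Nw; rewrite /= Nw.
apply: countable_bigcupT_measurable => [|c]; first exact: countableP.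
by case: ifP.
Qed.

Section Grid.
Context {R : realType} {d : nat}.
Implicit Types (x y : (2 ^ d).-tuple R).

Definition grid_index (k : nat) y : {ffun 'I_(2 ^ d) -> int} :=
  [ffun i => Num.floor (k.+1%:R * tnth y i)].

(* Coordinate 0 is not rounded down but set so that the coordinates sum to 1.  *)
Definition grid_point (k : nat) (c : {ffun 'I_(2 ^ d) -> int}) :
    (2 ^ d).-tuple R :=
  [tuple if i == idx0 d
         then 1 - \sum_(j < 2 ^ d | j != idx0 d) (c j)%:~R / k.+1%:R
         else (c i)%:~R / k.+1%:R | i < 2 ^ d].

Let rounding k y i : (grid_index k y i)%:~R / k.+1%:R <= tnth y i
  <= (grid_index k y i)%:~R / k.+1%:R + k.+1%:R^-1.
Proof.
have /andP[fl fu] := floor_itv (k.+1%:R * tnth y i).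
rewrite ffunE ler_pdivrMr// (mulrC (tnth y i)) fl/=.
rewrite -[X in _ + X]mul1r -mulrDl ler_pdivlMr// (mulrC (tnth y i)).
by move: fu; rewrite intrD => /ltW.
Qed.

(** Rounding down keeps the sum of the other coordinates at most 1 - y^0, so the mass left for
    coordinate 0 is nonnegative. *)
Lemma simplex_grid_point k y : simplex y ->
  simplex (grid_point k (grid_index k y)).
Proof.
move=> sy; split=> [i|].
  rewrite tnth_mktuple; case: ifPn => i0; last first.
    by rewrite divr_ge0// ffunE ler0z floor_ge0 mulr_ge0//; exact: sy.1.
  rewrite subr_ge0 (@le_trans _ _ (1 - tnth y (idx0 d)))//; last first.
    by rewrite gerBl; exact: sy.1.
  rewrite -simplex_sum_others//.
  by apply: ler_sum => j _; have /andP[] := rounding k y j.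
rewrite (bigD1 (idx0 d))//= tnth_mktuple eqxx addrC.
under eq_bigr => i /negbTE i0 do rewrite tnth_mktuple i0.
by rewrite addrCA subrr addr0.
Qed.

(** Each rounded coordinate errs by at most 1/(k+1), and coordinate 0 absorbs the sum of these
    errors; hence the factor 2. *)
Lemma l1norm_grid_point k y : simplex y ->
  l1norm (vsub (grid_point k (grid_index k y)) y) <=
  2 * \sum_(j < 2 ^ d | j != idx0 d) k.+1%:R^-1.
Proof.
move=> sy; set g := grid_point _ _.
have gy j : j != idx0 d -> `|tnth g j - tnth y j| <= k.+1%:R^-1.
  move=> /negbTE j0; rewrite tnth_mktuple j0 distrC /=.
  have /andP[gl gu] := rounding k y j.
  by rewrite ger0_norm ?subr_ge0// lerBlDl.
have g0 : tnth g (idx0 d) - tnth y (idx0 d) =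
    - \sum_(j < 2 ^ d | j != idx0 d) (tnth g j - tnth y j).
  rewrite sumrB !simplex_sum_others//; last exact: simplex_grid_point.
  by ring.
rewrite /l1norm (bigD1 (idx0 d))//= tnth_mktuple g0 normrN mulr_natl mulr2n.
apply: lerD; last by apply: ler_sum => j j0; rewrite tnth_mktuple gy.
by apply: (le_trans (ler_norm_sum _ _ _)); exact: ler_sum.
Qed.

Lemma cvg_grid (c : R) : (fun k : nat =>
  c * (2 * \sum_(j < 2 ^ d | j != idx0 d) k.+1%:R^-1)) @ \oo --> 0.
Proof.
under eq_fun do rewrite sumr_const -[X in 2 * X]mulr_natr.
under eq_fun do rewrite (mulrC _^-1) !mulrA.
set N := (X in c * 2 * X).
suff : (c * 2 * N * harmonic k) @[k --> \oo] --> c * 2 * N * 0.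
  by rewrite mulr0.
by apply: cvgMr; exact: cvg_harmonic.
Qed.

Context {disp : measure_display} {Omega : measurableType disp}.

Lemma measurable_grid_index_fiber (X : Omega -> (2 ^ d).-tuple R) k c :
  measurable_fun [set: Omega] X ->
  measurable ((grid_index k \o X) @^-1` [set c]).
Proof.
move=> mX.
have -> : (grid_index k \o X) @^-1` [set c] = \bigcap_(i in [set: 'I_(2 ^ d)])
    ((fun w => k.+1%:R * tnth (X w) i) @^-1` `[(c i)%:~R, (c i + 1)%:~R[).
  apply/seteqP; split=> [w /= <- i _ /=|w /= cw].
    by rewrite in_itv/= ffunE floor_itv.
  by apply/ffunP => i; rewrite ffunE; have /= := cw i Logic.I;
    rewrite in_itv/= => /floor_def.
apply: fin_bigcap_measurable => // i _; rewrite -[X in measurable X]setTI.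
have : measurable_fun [set: Omega] (fun w => k.+1%:R * tnth (X w) i).
  apply: measurable_funM => //.
  exact: (measurableT_comp (measurable_tnth i) mX).
move=> /(_ measurableT _ (measurable_itv `[(c i)%:~R, (c i + 1)%:~R[)).
by rewrite !setTI.
Qed.

(* T is arbitrary off the simplex, so T itself need not be measurable; this is *)
(* why X is approximated by countably valued maps into the simplex.            *)
Lemma measurable_Lipschitz_comp (T : (2 ^ d).-tuple R -> (2 ^ d).-tuple R)
    (L : R) (X : Omega -> (2 ^ d).-tuple R) :
  (forall x y, simplex x -> simplex y ->
     l1norm (vsub (T x) (T y)) <= L * l1norm (vsub x y)) -> 0 <= L ->
  measurable_fun [set: Omega] X -> (forall w, simplex (X w)) ->
  measurable_fun [set: Omega] (T \o X).
Proof.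
move=> TL L0 mX sX; apply/measurable_fun_tnthP => i.
pose F k (c : {ffun 'I_(2 ^ d) -> int}) := tnth (T (grid_point k c)) i.
apply: (@measurable_fun_cvg _ _ _ _ (fun k => F k \o (grid_index k \o X))).
  move=> k; apply: measurable_fun_countable_comp => c.
  exact: measurable_grid_index_fiber.
(* Grid point and X w both lie in the simplex, so the error in coordinate i is at most L times the
   grid error. *)
move=> w _; apply/subr_cvg0/norm_cvg0P.
apply: (@squeeze_cvgr _ _ _ _ (cst 0) _ _ _ _ _ (cvg_grid L)); last first.
  exact: cvg_cst.
apply: nearW => k; rewrite normr_ge0/=.
have sg := simplex_grid_point k (sX w).
apply: (le_trans _ (ler_wpM2l L0 (l1norm_grid_point k (sX w)))).
apply: (le_trans _ (TL _ _ sg (sX w))).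
rewrite /l1norm (bigD1 i)//= tnth_mktuple ler_wpDr//.
exact: sumr_ge0.
Qed.

Lemma measurable_q (th X : Omega -> (2 ^ d).-tuple R) :
  measurable_fun [set: Omega] th -> measurable_fun [set: Omega] X ->
  (forall w, 0 <= dotp (X w) (th w)) ->
  measurable_fun [set: Omega] (fun w => q (th w) (X w)).
Proof.
move=> mth mX D0; apply/measurable_fun_tnthP => i.
have mXth j : measurable_fun [set: Omega]
    (fun w => tnth (X w) j * tnth (th w) j).
  by apply: measurable_funM; [exact: (measurableT_comp (measurable_tnth j) mX)|
    exact: (measurableT_comp (measurable_tnth j) mth)].
(* Division is written as the power -1, which agrees with the inverse for a nonnegative base, 0
   included. *)
rewrite (_ : _ \o _ = fun w => tnth (X w) i * tnth (th w) i *
    dotp (X w) (th w) `^ (-1)); last first.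
  by apply/funext => w /=; rewrite tnth_mktuple powR_inv1.
apply: measurable_funM => //.
have mD : measurable_fun [set: Omega] (fun w => dotp (X w) (th w)).
  exact: measurable_sum.
exact: (measurableT_comp (measurable_powR _) mD).
Qed.

Lemma measurable_Q (T : (2 ^ d).-tuple R -> (2 ^ d).-tuple R) (L : R)
    (theta : nat -> Omega -> (2 ^ d).-tuple R) x n :
  Lip T = L%:E -> 0 <= L -> L <= 1 -> T e0 = e0 -> {homo T : x / simplex x} ->
  (forall n, measurable_fun [set: Omega] (theta n)) ->
  (forall n w i, 0 <= tnth (theta n w) i) ->
  (forall n w, tnth (theta n w) (idx0 d) = 1) ->
  simplex x -> 0 < tnth x (idx0 d) ->
  measurable_fun [set: Omega] (fun w => Q T (fun k => theta k w) n x).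
Proof.
move=> TL L0 L1 Te0 Ts mth th_ge0 th0 sx x0.
have sQ k w := Q_odds k TL L0 L1 Te0 Ts (th_ge0^~ w) (th0^~ w) sx x0.
elim: n => [|n IH] /=; first exact: measurable_cst.
apply: measurable_q => //.
  apply: measurable_Lipschitz_comp L0 IH _; first exact: Lip_l1norm_le.
  by move=> w; have [] := sQ n w.
move=> w; have [sQn _ _] := sQ n w; apply: sumr_ge0 => i _.
by rewrite mulr_ge0//; exact: (Ts _ sQn).1.
Qed.

End Grid.

(** * Independence and products of integrals *)

Section Independence.
Import HBNNSimple.
Context {R : realType} {disp : measure_display} {Omega : measurableType disp}.
Variable P : probability Omega R.
Local Open Scope ereal_scope.

(** The product formula passes from indicators to simple functions by linearity and to nonnegative
    measurable h by monotone convergence. In the application W is the product of the other factors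
    and c the product of their integrals. *)
Lemma integral_weighted_comp {disp'} {E : measurableType disp'}
    (W : Omega -> R) (Y : Omega -> E) (c : \bar R) (h : E -> R) :
  measurable_fun [set: Omega] W -> (forall w, 0 <= W w)%R ->
  measurable_fun [set: Omega] Y -> 0 <= c -> c \is a fin_num ->
  (forall A : set E, measurable A ->
     \int[P]_w (W w * \1_A (Y w))%:E = c * P (Y @^-1` A)) ->
  measurable_fun [set: E] h -> (forall y, 0 <= h y)%R ->
  \int[P]_w (W w * h (Y w))%:E = c * \int[P]_w (h (Y w))%:E.
Proof.
move=> mW W0 mY c0 cfin WA mh h0.
have mhE : measurable_fun [set: E] (EFin \o h) by exact/measurable_EFinP.
pose g := nnsfun_approx measurableT mhE.
have mgY n : measurable_fun [set: Omega] (fun w => g n (Y w)).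
  by apply: measurableT_comp mY; exact: measurable_funPT.
have ndg w : {homo (fun n => g n (Y w)) : m n / (m <= n)%N >-> (m <= n)%R}.
  by move=> m n mn; exact/lefP/nd_nnsfun_approx.
have cvgg w : (g n (Y w))%:E @[n --> \oo] --> (h (Y w))%:E.
  by apply: cvg_nnsfun_approx => // y _; rewrite /= lee_fin.
have intg n : \int[P]_w (W w * g n (Y w))%:E = c * \int[P]_w (g n (Y w))%:E.
  have mA y : measurable (g n @^-1` [set y]).
    by rewrite -[X in measurable X]setTI; exact: measurable_funPT.
  have mI y : measurable_fun [set: Omega]
      (fun w => \1_(g n @^-1` [set y]) (Y w) : R).
    by apply: measurableT_comp mY; exact: measurable_indic.
  (* The sign of y is not assumed: where the indicator is nonzero, y is a value of the nonnegative
     function [g n]. *)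
  have yI0 y w : (0 <= y * \1_(g n @^-1` [set y]) (Y w) :> R)%R.
    rewrite indicE; have [/set_mem/= <-|_] := boolP (_ \in _).
      by rewrite mulr1.
    by rewrite mulr0.
  have gE w : (g n (Y w))%:E = \sum_(y \in range (g n))
      (y * \1_(g n @^-1` [set y]) (Y w))%:E.
    by rewrite fimfunE fsumEFin.
  have WgE w : (W w * g n (Y w))%:E = \sum_(y \in range (g n))
      (W w * (y * \1_(g n @^-1` [set y]) (Y w)))%:E.
    rewrite EFinM gE ge0_mule_fsumr; last by move=> y; rewrite lee_fin.
    by apply: eq_fsbigr => y _; rewrite EFinM.
  under eq_integral do rewrite WgE.
  under [in RHS]eq_integral do rewrite gE.
  rewrite !ge0_integral_fsum//; last 4 first.
  - by move=> y; apply/measurable_EFinP/measurable_funM.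
  - by move=> y w _; rewrite lee_fin.
  - by move=> y; apply/measurable_EFinP/measurable_funM => //;
      exact: measurable_funM.
  - by move=> y w _; rewrite lee_fin mulr_ge0.
  rewrite ge0_mule_fsumr//; last first.
    by move=> y; apply: integral_ge0 => w _; rewrite lee_fin.
  apply: eq_fsbigr => y /set_mem[z _ gzy].
  have y0 : (0 <= y)%R by rewrite -gzy.
  under eq_integral do rewrite mulrCA EFinM.
  under [in RHS]eq_integral do rewrite EFinM.
  rewrite !ge0_integralZl//; last 3 first.
  - exact/measurable_EFinP.
  - exact/measurable_EFinP/measurable_funM.
  - by move=> w _; rewrite lee_fin mulr_ge0.
  rewrite WA// muleCA; congr (_ * (_ * _)).
  rewrite -[X in P X]setIT -integral_indic//.
  by rewrite -[X in measurable X]setTI; exact: mY.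
have L : \int[P]_w (W w * g n (Y w))%:E @[n --> \oo] -->
    \int[P]_w (W w * h (Y w))%:E.
  rewrite [X in _ --> X](_ : _ =
      \int[P]_w limn (fun n => (W w * g n (Y w))%:E)); last first.
    apply: eq_integral => w _; apply/esym/cvg_lim => //.
    under eq_fun do rewrite EFinM; rewrite EFinM.
    by apply: cvgeZl => //; exact: cvgg.
  apply: cvg_monotone_convergence => //.
  - by move=> n; apply/measurable_EFinP/measurable_funM.
  - by move=> n w _; rewrite lee_fin mulr_ge0.
  - by move=> w _ m n mn; rewrite lee_fin ler_wpM2l// ndg.
have Rr : \int[P]_w (g n (Y w))%:E @[n --> \oo] --> \int[P]_w (h (Y w))%:E.
  rewrite [X in _ --> X](_ : _ =
      \int[P]_w limn (fun n => (g n (Y w))%:E)); last first.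
    by apply: eq_integral => w _; apply/esym/cvg_lim => //; exact: cvgg.
  apply: cvg_monotone_convergence => //.
  - by move=> n; apply/measurable_EFinP.
  - by move=> n w _; rewrite lee_fin.
  - by move=> w _ m n mn; rewrite lee_fin ndg.
rewrite -(cvg_lim _ L)//; under eq_fun do rewrite intg.
by apply/cvg_lim => //; exact: cvgeZl.
Qed.

(** The product is the indicator of an intersection, so this is independence for the index set {0,
    ..., n-1}. *)
Lemma independent_indic_prod {disp'} {E : measurableType disp'}
    (Y : nat -> Omega -> E) (A : nat -> set E) n :
  mutually_independent P Y -> (forall i, measurable_fun [set: Omega] (Y i)) ->
  (forall i, measurable (A i)) ->
  \int[P]_w (\prod_(i < n) \1_(A i) (Y i w))%:E =
  \prod_(i < n) \int[P]_w (\1_(A i) (Y i w))%:E.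
Proof.
move=> indY mY mA.
have mYA i : measurable (Y i @^-1` A i).
  by rewrite -[X in measurable X]setTI; exact: mY.
transitivity (P (\bigcap_(i in `I_n) (Y i @^-1` A i))).
  rewrite -[X in P X]setIT -integral_indic//; last exact: bigcap_measurableType.
  apply: eq_integral => w _; congr (_%:E); rewrite !indicE.
  have [/set_mem/= wA|wA] := boolP (_ \in _).
    by apply: big1 => i _; rewrite indicE mem_set//; exact: (wA i (ltn_ord i)).
  apply/eqP; rewrite prodf_seq_eq0; apply: contraNT wA => /hasPn nA.
  apply/mem_set => i /= ni; have := nA (Ordinal ni) (mem_index_enum _).
  by rewrite indicE pnatr_eq0 eqb0 negbK => /set_mem.
have -> : `I_n = [set` [fset i | i in iota 0 n]%fset].
  by apply/seteqP; split=> i /=; rewrite in_fset/= mem_iota.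
rewrite indY//.
transitivity (\prod_(i <- iota 0 n) P (Y i @^-1` A i)).
  apply: perm_big; apply: uniq_perm; rewrite ?fset_uniq ?iota_uniq//.
  by move=> i; rewrite in_fset.
rewrite -{1}[n]subn0 -/(index_iota 0 n) big_mkord; apply: eq_bigr => i _.
by rewrite -[X in P X]setIT -integral_indic.
Qed.

Lemma independent_integral_prod {disp'} {E : measurableType disp'}
    (Y : nat -> Omega -> E) (h : nat -> E -> R) n :
  mutually_independent P Y -> (forall i, measurable_fun [set: Omega] (Y i)) ->
  (forall i, measurable_fun [set: E] (h i)) -> (forall i y, 0 <= h i y)%R ->
  (forall i, \int[P]_w (h i (Y i w))%:E \is a fin_num) ->
  \int[P]_w (\prod_(i < n) h i (Y i w))%:E =
  \prod_(i < n) \int[P]_w (h i (Y i w))%:E.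
Proof.
move=> indY mY.
(* replace the indicators of [independent_indic_prod] one coordinate at a time *)
suff H m : (m <= n)%N -> forall (g : nat -> E -> R),
    (forall i, measurable_fun [set: E] (g i)) -> (forall i y, 0 <= g i y)%R ->
    (forall i, \int[P]_w (g i (Y i w))%:E \is a fin_num) ->
    (forall i, (m <= i)%N ->
       exists2 A : set E, measurable A & g i = \1_A) ->
    \int[P]_w (\prod_(i < n) g i (Y i w))%:E =
    \prod_(i < n) \int[P]_w (g i (Y i w))%:E.
  move=> mh h0 hfin.
  (* At m = n every factor of index at least n must be an indicator; these factors do not enter the
     product, and the empty set serves. *)
  pose g i := if (i < n)%N then h i else \1_set0.
  have gh (i : 'I_n) : g i = h i by rewrite /g ltn_ord.
  under eq_integral do under eq_bigr do rewrite -gh.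
  under [in RHS]eq_bigr do rewrite -gh.
  apply: (H n) => //.
  - by move=> i; rewrite /g; case: ifP => // _; exact: measurable_indic.
  - by move=> i y; rewrite /g; case: ifP.
  - move=> i; rewrite /g; case: ifP => // _.
    by under eq_integral do rewrite indic0; rewrite integral0.
  - by move=> i ni; exists set0 => //; rewrite /g ltnNge ni.
elim: m => [_ g mg g0 gfin gA|m IH mn g mg g0 gfin gA].
  have /choice[A gA'] : forall i, exists A, measurable A /\ g i = \1_A.
    by move=> i; have [//|A] := gA i; exists A.
  under eq_integral do under eq_bigr => i _ do rewrite (gA' i).2.
  under [in RHS]eq_bigr => i _ do under eq_integral do rewrite (gA' i).2.
  by apply: independent_indic_prod => // i; exact: (gA' i).1.
pose j := Ordinal mn.
pose W w := (\prod_(i < n | i != j) g i (Y i w))%R.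
rewrite (bigD1 j)//= muleC.
have -> : \int[P]_w (\prod_(i < n) g i (Y i w))%:E =
    \int[P]_w (W w * g j (Y j w))%:E.
  by apply: eq_integral => w _; rewrite (bigD1 j)//= mulrC.
apply: integral_weighted_comp => //.
- rewrite /W; under eq_fun do rewrite big_mkcond/=.
  apply: measurable_prod => i _; case: (i != j) => //.
  exact: (measurableT_comp (mg i) (mY i)).
- by move=> w; apply: prodr_ge0.
- by apply: prode_ge0 => i _; apply: integral_ge0 => w _; rewrite lee_fin.
- exact: prode_fin_num.
(* With factor m replaced by an indicator, the induction hypothesis supplies the formula on
   indicators that [integral_weighted_comp] extends. *)
move=> A mA; pose g' i := if i == m then \1_A else g i.
have g'j : g' j = \1_A by rewrite /g' eqxx.
have g'E (i : 'I_n) : i != j -> g' i = g i.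
  by rewrite /g' => ij; case: ifPn ij => // /eqP im /eqP; case; exact: val_inj.
have intA : \int[P]_w (\1_A (Y m w))%:E = P (Y m @^-1` A).
  rewrite -[X in P X]setIT -integral_indic//.
  by rewrite -[X in measurable X]setTI; exact: mY.
have {}IH : \int[P]_w (\prod_(i < n) g' i (Y i w))%:E =
    \prod_(i < n) \int[P]_w (g' i (Y i w))%:E.
  apply: IH => [|i|i y|i|i]; first exact: ltnW.
  - by rewrite /g'; case: ifP => // _; exact: measurable_indic.
  - by rewrite /g'; case: ifP.
  - by rewrite /g'; case: eqP => // ->; rewrite intA fin_num_measure//;
      rewrite -[X in measurable X]setTI; exact: mY.
  - rewrite /g'; case: eqVneq => [_ _|im mi]; first by exists A.
    by apply: gA; rewrite ltn_neqAle eq_sym im.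
transitivity (\int[P]_w (\prod_(i < n) g' i (Y i w))%:E).
  apply: eq_integral => w _; rewrite (bigD1 j)//= g'j mulrC.
  by congr (_ * _)%:E; apply: eq_bigr => i ij; rewrite g'E.
rewrite IH (bigD1 j)//= g'j intA muleC; congr (_ * _).
by apply: eq_bigr => i ij; rewrite g'E.
Qed.

End Independence.

(** * Sub-Gaussian tail bound *)

Section Mgf.
Context {R : realType}.

(** From 1 - x/2 <= exp(-x/2) one gets exp x <= (1 - x/2)^(-2), and the rest is a polynomial
    inequality. *)
Lemma expR_le_quadratic (x : R) : x <= 1 -> expR x <= 1 + x + 2 * x ^+ 2.
Proof.
move=> x1; have h : 0 < 1 - x / 2 by lra.
have E : expR x = (expR (- (x / 2))) ^- 2.
  by rewrite -expRM_natl -expRN; congr expR; field.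
have : (1 - x / 2) ^+ 2 <= expR (- (x / 2)) ^+ 2.
  rewrite ler_pXn2r// ?nnegrE ?expR_ge0 ?(ltW h)//.
  by have := expR_ge1Dx (- (x / 2)); lra.
rewrite -(@lef_pV2 R) ?posrE ?exprn_gt0 ?expR_gt0// -E => /le_trans; apply.
rewrite -div1r ler_pdivrMr ?exprn_gt0//.
rewrite -subr_ge0 (_ : _ - _ = x ^+ 2 * ((1 - x) * (5 / 4 - x / 2))); last first.
  by field.
by rewrite mulr_ge0 ?sqr_ge0// mulr_ge0; lra.
Qed.

(** This isolates the linear term, which integrates to the mean, from a Gaussian term controlled by
    [psi2]. *)
Lemma expR_le_add_sqr (x : R) : expR x <= x + expR (2 * x ^+ 2).
Proof.
have [x1|x1] := leP x 1.
  have := expR_ge1Dx (2 * x ^+ 2); have := expR_le_quadratic x1; lra.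
suff : expR x <= expR (2 * x ^+ 2) by lra.
by rewrite ler_expR; nra.
Qed.

(** Convexity of the exponential on the segment from 0 to z. *)
Lemma expR_mul_le (t z : R) : 0 <= t <= 1 ->
  expR (t * z) <= 1 + t * (expR z - 1).
Proof.
move=> /andP[t0 t1]; have a0 := expR_ge0 (t * z).
(* average the tangent line at t * z, which lies below expR at 0 and at z *)
have ez : expR (t * z) * (1 + (1 - t) * z) <= expR z.
  rewrite (_ : expR z = expR (t * z) * expR ((1 - t) * z)); last first.
    by rewrite -expRD; congr expR; ring.
  by rewrite ler_wpM2l// expR_ge1Dx.
have e1 : expR (t * z) * (1 - t * z) <= 1.
  by rewrite -[leRHS](expRxMexpNx_1 (t * z)) ler_wpM2l// expR_ge1Dx.
rewrite -subr_ge0 (_ : _ - _ = t * (expR z - expR (t * z) * (1 + (1 - t) * z))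
  + (1 - t) * (1 - expR (t * z) * (1 - t * z))); last by ring.
by rewrite addr_ge0// mulr_ge0 ?subr_ge0.
Qed.
End Mgf.

(** * Moment generating function of one sub-Gaussian variable *)

Section Subgaussian.
Context {R : realType} {disp : measure_display} {Omega : measurableType disp}.
Variable P : probability Omega R.
Variables (Y : Omega -> R) (C : R).
Hypotheses (mY : measurable_fun [set: Omega] Y) (C0 : 0 < C).
Hypothesis Y_psi2 : ('E_P[fun w => psi2 (`|Y w| / C)] <= 1)%E.

Let Z w := psi2 (`|Y w| / C).

Let ZE w : Z w = expR ((Y w / C) ^+ 2) - 1.
Proof. by rewrite /Z /psi2 !expr_div_n real_normK ?num_real. Qed.

Let Z_ge w : (Y w / C) ^+ 2 <= Z w.
Proof. by rewrite ZE lerBrDl; exact: expR_ge1Dx. Qed.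

Let Z_ge0 w : 0 <= Z w.
Proof. exact: le_trans (sqr_ge0 _) (Z_ge w). Qed.

Let mZ : measurable_fun [set: Omega] Z.
Proof.
rewrite (_ : Z = fun w => expR ((Y w / C) ^+ 2) - 1); last first.
  by apply/funext => w; rewrite ZE.
apply: measurable_funB => //; apply: measurableT_comp => //.
by apply: measurable_funX; exact: measurable_funM.
Qed.

Let intZ_le1 : (\int[P]_w (Z w)%:E <= 1)%E.
Proof. by move: Y_psi2; rewrite unlock. Qed.

Let intZ : P.-integrable [set: Omega] (EFin \o Z).
Proof.
apply/integrableP; split; first exact/measurable_EFinP.
under eq_integral do rewrite /= ger0_norm//.
exact: le_lt_trans intZ_le1 (ltry _).
Qed.

(** With u = Y / C, |u| <= 1 + u^2 <= 1 + Z. *)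
Lemma psi2_integrable : P.-integrable [set: Omega] (EFin \o Y).
Proof.
have intCZ : P.-integrable [set: Omega] (fun w => (C * (1 + Z w))%:E).
  rewrite (_ : (fun _ => _) = (fun w => C%:E * (1 + (Z w)%:E))%E)//.
  apply: integrableZl => //; apply: integrableD => //.
  exact: finite_measure_integrable_cst.
apply: le_integrable intCZ => //; first exact/measurable_EFinP.
move=> w _; rewrite lee_fin [leRHS]ger0_norm; last first.
  by rewrite mulr_ge0 ?(ltW C0)// addr_ge0.
have -> : `|Y w| = C * `|Y w / C|.
  by rewrite normrM normfV (gtr0_norm C0); field; rewrite gt_eqF.
rewrite ler_pM2l//; have := Z_ge w; rewrite -real_normK ?num_real//.
by move: (`|Y w / C|) => u; nra.
Qed.

(** What is known about Y is its mean and that Z has expectation at most 1, so expectations are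
    bounded through pointwise bounds affine in Y and Z. *)
Let integral_le_affine (f : Omega -> R) (a b e m : R) :
  measurable_fun [set: Omega] f -> (forall w, 0 <= f w) -> 0 <= e ->
  (\int[P]_w (Y w)%:E = m%:E)%E ->
  (forall w, f w <= a + b * Y w + e * Z w) ->
  (\int[P]_w (f w)%:E <= (a + b * m + e)%:E)%E.
Proof.
move=> mf f0 e0 Ym fle.
have intY := psi2_integrable.
have ia : P.-integrable [set: Omega] (fun=> a%:E).
  exact: finite_measure_integrable_cst.
have ib : P.-integrable [set: Omega] (fun w => b%:E * (Y w)%:E)%E.
  exact: integrableZl.
have ie : P.-integrable [set: Omega] (fun w => e%:E * (Z w)%:E)%E.
  exact: integrableZl.
have iab := integrableD measurableT ia ib.
have iabe := integrableD measurableT iab ie.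
apply: (@le_trans _ _ (\int[P]_w (a%:E + b%:E * (Y w)%:E + e%:E * (Z w)%:E))%E).
  apply: ge0_le_integral => //.
  - by move=> w _; rewrite lee_fin.
  - exact/measurable_EFinP.
  - exact: measurable_int iabe.
  - by move=> w _; rewrite -!EFinM -!EFinD lee_fin.
rewrite integralD// integralD//.
have -> : (\int[P]_w a%:E = a%:E)%E.
  by rewrite -[RHS](expectation_cst P a) unlock.
rewrite !integralZl// Ym !EFinD EFinM leeD2l//.
by rewrite -[leRHS]mule1 lee_wpmul2l.
Qed.

Lemma mgf_le (lam mu : R) : 0 <= lam -> ('E_P[Y] <= mu%:E)%E ->
  (\int[P]_w (expR (lam * Y w))%:E <=
     (expR (lam * mu + 5 * (lam * C) ^+ 2))%:E)%E.
Proof.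
move=> lam0; rewrite unlock => Ymu.
have [m Ym] : exists m, (\int[P]_w (Y w)%:E = m%:E)%E.
  exists (fine (\int[P]_w (Y w)%:E)); rewrite fineK//.
  exact: integrable_fin_num psi2_integrable.
have mmu : m <= mu by rewrite -lee_fin -Ym.
(* Integrate 0 <= C (u + 1)^2 / 2 <= C (1/2 + u + Z/2), where u = Y / C. *)
have mCm : - m <= C.
  have : (\int[P]_w (cst 0 w)%:E <= (C / 2 + 1 * m + C / 2)%:E)%E.
    apply: integral_le_affine => //; first by rewrite divr_ge0// ltW.
    move=> w /=; have -> : Y w = C * (Y w / C) by field; rewrite gt_eqF.
    have := Z_ge w; move: (Y w / C) (Z w) => u z uz.
    rewrite (_ : _ + _ = C * (1 / 2 + u + z / 2)); last by ring.
    rewrite mulr_ge0 ?(ltW C0)//.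
    by have := sqr_ge0 (u + 1); rewrite sqrrD; lra.
  by rewrite integral0 lee_fin; lra.
have mexp : measurable_fun [set: Omega] (fun w => expR (lam * Y w)).
  by apply: measurableT_comp => //; exact: measurable_funM.
set s := lam * C; have s0 : 0 <= s by rewrite mulr_ge0// ltW.
have lamY w : lam * Y w = s * (Y w / C) by rewrite /s; field; rewrite gt_eqF.
(* For 2 s^2 <= 1 this number is the weight in [expR_mul_le], which gives exp(2 (lam Y)^2) <= 1 + 2
   s^2 Z. Otherwise s u <= s^2 + u^2 yields the cruder bound 2 exp(s^2). *)
have [s_small|s_large] := leP (2 * s ^+ 2) 1.
  apply: (@le_trans _ _ (1 + lam * m + 2 * s ^+ 2)%:E).
    apply: integral_le_affine => //; first by rewrite mulr_ge0// sqr_ge0.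
    move=> w; apply: (le_trans (expR_le_add_sqr _)).
    suff : expR (2 * (lam * Y w) ^+ 2) <= 1 + 2 * s ^+ 2 * Z w by lra.
    rewrite lamY exprMn mulrA ZE.
    by apply: expR_mul_le; rewrite s_small mulr_ge0// sqr_ge0.
  rewrite lee_fin -addrA; apply: (le_trans (expR_ge1Dx _)).
  rewrite ler_expR lerD//; first by rewrite ler_wpM2l.
  by rewrite ler_wpM2r ?sqr_ge0// ler_nat.
apply: (@le_trans _ _ (expR (s ^+ 2) + 0 * m + expR (s ^+ 2))%:E).
  apply: integral_le_affine => //.
  move=> w; rewrite mul0r addr0 ZE mulrBr mulr1 addrC subrK -expRD ler_expR lamY.
  by move: (Y w / C) => u; nra.
rewrite lee_fin mul0r addr0.
apply: (@le_trans _ _ (expR (2 * s ^+ 2) * expR (s ^+ 2))).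
  rewrite -mulr2n -[leLHS]mulr_natl ler_wpM2r ?expR_ge0//.
  by apply: le_trans (expR_ge1Dx _); lra.
rewrite -expRD ler_expR.
(* The crude bound ignores the mean; since mu >= -C and s <= 2 s^2 here, lam mu costs at most 2 s^2,
   and 3 + 2 gives the constant 5. *)
have : lam * - mu <= s.
  by rewrite /s ler_wpM2l//; apply: le_trans mCm; rewrite lerN2.
by nra.
Qed.

End Subgaussian.

(** * Chernoff's bound for sums of independent sub-Gaussian variables *)

Section Tail.
Context {R : realType} {disp : measure_display} {Omega : measurableType disp}.
Variable P : probability Omega R.

Lemma mgf_le_psi2_norm (Y : Omega -> R) (sigma mu lam : R) :
  measurable_fun [set: Omega] Y -> 0 < sigma ->
  (psi2_norm P Y <= sigma%:E)%E -> ('E_P[Y] <= mu%:E)%E -> 0 <= lam ->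
  (\int[P]_w (expR (lam * Y w))%:E <=
     (expR (lam * mu + 20 * (lam * sigma) ^+ 2))%:E)%E.
Proof.
move=> mY s0 Ys Ymu lam0.
(* the infimum defining [psi2_norm] need not be attained, hence the slack *)
have : (psi2_norm P Y < (2 * sigma)%:E)%E.
  by apply: le_lt_trans Ys _; rewrite lte_fin; lra.
move=> /ereal_inf_lt[_ [C [C0 YC] <-]]; rewrite lte_fin => C2s.
apply: (le_trans (mgf_le mY C0 YC lam0 Ymu)).
(* Replacing C by 2 sigma turns the constant 5 into 20. *)
rewrite lee_fin ler_expR lerD2l.
have : (lam * C) ^+ 2 <= (lam * (2 * sigma)) ^+ 2.
  rewrite ler_pXn2r ?nnegrE ?mulr_ge0 ?(ltW C0)//; last by lra.
  by rewrite ler_wpM2l// ltW.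
by rewrite [lam * (2 * _)]mulrCA exprMn; lra.
Qed.

Lemma subgaussian_sum_tail (Y : nat -> Omega -> R) (sigma mu : R) n (eps : R) :
  (forall i, measurable_fun [set: Omega] (Y i)) ->
  mutually_independent P Y -> 0 < sigma -> 0 < eps ->
  (forall i, psi2_norm P (Y i) <= sigma%:E)%E ->
  (forall i, 'E_P[Y i] <= mu%:E)%E ->
  (P [set w | (n%:R * (mu + eps) <= \sum_(i < n) Y i w)%R] <=
    (expR (- (80^-1 * n%:R * eps ^+ 2 / sigma ^+ 2)))%:E)%E.
Proof.
move=> mY indY s0 e0 Ys Ymu.
(* The minimiser of - lam eps + 20 (lam sigma)^2; the minimum is - eps^2 / (80 sigma^2). *)
pose lam := eps / (40 * sigma ^+ 2).
have lam0 : 0 < lam by rewrite divr_gt0// mulr_gt0// exprn_gt0.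
pose b := expR (lam * mu + 20 * (lam * sigma) ^+ 2).
have mgfY i : (\int[P]_w (expR (lam * Y i w))%:E <= b%:E)%E.
  exact: mgf_le_psi2_norm (mY i) s0 (Ys i) (Ymu i) (ltW lam0).
have mgf0 i : (0 <= \int[P]_w (expR (lam * Y i w))%:E)%E.
  by apply: integral_ge0 => w _; rewrite lee_fin expR_ge0.
have mgf_fin i : (\int[P]_w (expR (lam * Y i w))%:E)%E \is a fin_num.
  by rewrite ge0_fin_numE//; exact: le_lt_trans (mgfY i) (ltry _).
have mS : measurable_fun [set: Omega] (fun w => \sum_(i < n) Y i w).
  exact: measurable_sum.
pose S : {RV P >-> R} := mfun_Sub (mem_set mS).
apply: (le_trans (chernoff S (n%:R * (mu + eps)) lam0)).
have -> : 'M_P S lam = (\int[P]_w (\prod_(i < n) expR (lam * Y i w))%:E)%E.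
  rewrite /mmt_gen_fun unlock; apply: eq_integral => w _ /=.
  by rewrite -expR_sum -mulr_sumr mulrC.
rewrite (independent_integral_prod
  (h := fun _ y => expR (lam * y)))//; last first.
  by move=> i; apply: measurableT_comp => //; exact: measurable_funM.
under eq_bigr do rewrite -(fineK (mgf_fin _)).
rewrite prodEFin -EFinM lee_fin.
apply: (@le_trans _ _ (b ^+ n * expR (- (lam * (n%:R * (mu + eps)))))).
  rewrite ler_wpM2r ?expR_ge0// -[X in b ^+ X]card_ord -prodr_const.
  apply: ler_prod => i _; rewrite fine_ge0//=.
  by rewrite -lee_fin fineK.
rewrite -expRM_natl -expRD ler_expR le_eqVlt; apply/orP; left; apply/eqP.
by rewrite /lam; field; rewrite gt_eqF.
Qed.

End Tail.

(** * The pathwise contraction combined with the tail bound *)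

Theorem theorem1 (R : realType) :
  exists c : R, 0 < c /\
  forall (d : nat) (hd : (1 <= d)%N)
    (disp : measure_display) (Omega : measurableType disp)
    (P : probability Omega R)
    (theta : nat -> Omega -> (2 ^ d).-tuple R)
    (theta_iid : iid P theta)
    (theta_ge0 : forall n w i, 0 <= tnth (theta n w) i)
    (theta_0 : forall n w, tnth (theta n w) (idx0 d) = 1)
    (Istar sigma : R) (Istar_gt0 : 0 < Istar) (sigma_gt0 : 0 < sigma)
    (theta_star_gt0 : forall n, {ae P, forall w, 0 < theta_star (theta n w)})
    (log_iid : iid P (fun n w => ln (theta_star (theta n w))))
    (log_mean : forall n,
       ('E_P[fun w => ln (theta_star (theta n w))] <= (- Istar)%:E)%E)
    (log_subgaussian : forall n,
       (psi2_norm P (fun w => ln (theta_star (theta n w))) <= sigma%:E)%E)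
    (T : (2 ^ d).-tuple R -> (2 ^ d).-tuple R)
    (T_simplex : {homo T : x / simplex x})
    (L : R) (T_Lip : Lip T = L%:E) (L_le1 : L <= 1)
    (T_e0 : T e0 = e0)
    (x : (2 ^ d).-tuple R) (x_simplex : simplex x)
    (x0_gt0 : 0 < tnth x (idx0 d))
    (n : nat) (eps : R) (eps_gt0 : 0 < eps),
  let E := [set w | l1norm (vsub (Q T (fun k => theta k w) n x) e0)
              <= 2 * ((1 - tnth x (idx0 d)) / tnth x (idx0 d))
                   * (L * expR (- Istar + eps)) ^+ n] in
  measurable E /\
  ((1 - expR (- (c * n%:R * eps ^+ 2 / sigma ^+ 2)))%:E <= P E)%E.
Proof.
(* The constant of [subgaussian_sum_tail]. *)
exists 80^-1; split; first by rewrite invr_gt0.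
move=> d hd disp Omega P theta [mtheta _ _] theta_ge0 theta_0 Istar sigma _
  sigma_gt0 _ [mlog indep_log _] log_mean log_subgaussian T T_simplex L T_Lip
  L_le1 T_e0 x x_simplex x0_gt0 n eps eps_gt0 E.
have L0 := Lip_ge0 T_Lip hd.
have QP w := Q_odds n T_Lip L0 L_le1 T_e0 T_simplex (theta_ge0^~ w)
  (theta_0^~ w) x_simplex x0_gt0.
have mQ := measurable_Q n T_Lip L0 L_le1 T_e0 T_simplex mtheta theta_ge0
  theta_0 x_simplex x0_gt0.
have mE : measurable E.
  have mnorm : measurable_fun [set: Omega]
      (fun w => l1norm (vsub (Q T (fun k => theta k w) n x) e0)).
    apply: measurable_sum => i.
    under eq_fun do rewrite tnth_mktuple.
    apply: measurableT_comp => //; apply: measurable_funB => //.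
    exact: (measurableT_comp (measurable_tnth i) mQ).
  rewrite /E -[X in measurable X]setTI; apply: measurable_fun_le => //.
split=> //.
pose S w := \sum_(i < n) ln (theta_star (theta i w)).
pose B := [set w | n%:R * (- Istar + eps) <= S w].
have mB : measurable B.
  rewrite /B -[X in measurable X]setTI; apply: measurable_fun_le => //.
  exact: measurable_sum.
have PB := subgaussian_sum_tail n mlog indep_log sigma_gt0 eps_gt0
  log_subgaussian log_mean.
apply: (@le_trans _ _ (P (~` B))).
  by rewrite probability_setC// EFinB leeB.
apply: le_measure; rewrite ?inE//; first exact: measurableC.
move=> w /= /negP; rewrite -ltNge => SB.
have [sQ Q0 Qodds] := QP w.
apply: (le_trans (l1norm_sub_e0_le_odds sQ Q0)).
rewrite -mulrA ler_pM2l//; apply: (le_trans Qodds).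
rewrite -/(odds x) mulrC ler_wpM2l ?odds_ge0// exprMn ler_wpM2l ?exprn_ge0//.
(* Since [ln] is 0 at 0, exp(S w) is the product of the [theta_star] only when all of them are
   positive; otherwise that product is 0. *)
have [all_gt0|] := boolP [forall k : 'I_n, 0 < theta_star (theta k w)].
  rewrite -expRM_natl; apply: le_trans (_ : expR (S w) <= _); last first.
    by rewrite ler_expR ltW.
  rewrite expR_sum ler_prod// => i _; rewrite theta_star_ge0/= lnK//.
  by rewrite posrE; exact: (forallP all_gt0).
rewrite negb_forall => /existsP[k]; rewrite -leNgt => thk.
have -> : \prod_(k < n) theta_star (theta k w) = 0.
  have th0 : theta_star (theta k w) = 0.
    by apply/le_anti; rewrite thk theta_star_ge0.
  by rewrite (bigD1 k)//= th0 mul0r.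
by rewrite exprn_ge0 ?expR_ge0.
Qed.
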